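(* Let $k\geq 0$ be an integer and let $D$ be a 2-strong digraph of order $n\geq 3$. Let $z\in V(D)$ be a vertex such that every vertex of $V(D)\setminus\{z\}$ has degree at least $n+k$ in $D$ and $z$ has degree at least $n-k-4$ in $D$. If $D$ has a cycle of length at least $n-k-2$ that passes through $z$, then $D$ is Hamiltonian.
   Context: All digraphs are finite, without loops and without multiple arcs (a pair of opposite arcs $xy$, $yx$ is allowed). The order of a digraph $D$ is its number of vertices. The degree of a vertex $x$ is $d(x)=d^+(x)+d^-(x)$, where $d^+(x)$ and $d^-(x)$ are the numbers of out-neighbours and in-neighbours of $x$. All paths and cycles are simple and directed; the length of a cycle is its number of arcs, and cycles of length 2 are allowed. A digraph is Hamiltonian if it contains a cycle that includes every vertex. A digraph $D$ is strong if for every pair $x,y$ of distinct vertices there is an $(x,y)$-path and a $(y,x)$-path in $D$. A digraph $D$ is 2-strong if $|V(D)|\geq 3$ and for every set $A\subseteq V(D)$ of at most one vertex, $D-A$ (the subdigraph induced by $V(D)\setminus A$) is strong. *)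

(* Defs.v *)
From mathcomp Require Import all_boot.

Set Implicit Arguments.
Unset Strict Implicit.
Unset Printing Implicit Defensive.

(* A digraph is a finite vertex type T with an irreflexive arc relation e,    *)
(* where e x y means that the arc xy is present; the irreflexivity is a        *)
(* hypothesis wherever it is needed.                                           *)
Section Digraph.

Variables (T : finType) (e : rel T).
Implicit Types (x y : T) (p c : seq T).

Definition outdeg x : nat := #|[set y | e x y]|.
Definition indeg x : nat := #|[set y | e y x]|.
Definition deg x : nat := outdeg x + indeg x.

(* As in path.v, p omits the initial vertex x. *)
Definition dipath x y p : Prop := [/\ path e x p, last x p = y & uniq (x :: p)].

Definition strong : Prop :=
  forall x y, x != y -> (exists p, dipath x y p) /\ (exists p, dipath y x p).

(* c lists each vertex of the cycle once, so its length is size c.  The bound  *)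
(* on the size excludes the empty sequence, which satisfies ucycle.            *)
Definition dicycle c : Prop := 1 < size c /\ ucycle e c.

Definition hamiltonian : Prop := exists c, dicycle c /\ forall x, x \in c.

End Digraph.

(* The arc relation of D - A, on the type of vertices outside A. *)
Definition del_rel (T : finType) (e : rel T) (A : {set T}) :
  rel {x : T | x \notin A} := relpre val e.

Definition two_strong (T : finType) (e : rel T) : Prop :=
  3 <= #|T| /\ forall A : {set T}, #|A| <= 1 -> strong (@del_rel T e A).

(* Main.v *)
(** Let C = z x_1 ... x_{m-1} z be a longest cycle through z and suppose that it
    is not Hamiltonian.  A vertex y off C cannot be inserted in C, so it has at
    most m arcs to and from C; the degree condition then forces exactly k + 2
    vertices off C, which form a complete digraph R and share one pattern: for
    some pivot l, R has arcs exactly to x_1, ..., x_l and from x_l, ..., x_{m-1},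
    and none to or from z.  Thus two vertices of R can be used twice to jump
    back from any position >= l to any position <= l, and every cycle through z
    obtained this way has length at most m, or has length m and a pivot again.
    As z has degree at least m - 2, at most two positions t of C have neither
    x_t z nor z x_{t+1} as arcs.  Since there are no arcs z x_i', x_i z with
    i < l < i', up to reversal of all arcs z has no out-neighbour beyond the
    pivot.  Strength of D - x_l then gives an arc x_i x_j with i < l < j, whose
    rerouted cycles forbid so many arcs at z and near x_i, x_j that the deletion
    of some single vertex disconnects D. *)

Require Import Defs.
From mathcomp Require Import all_boot zify.

Set Implicit Arguments.
Unset Strict Implicit.
Unset Printing Implicit Defensive.

(** * Cycles assembled from intervals of positions *)

(* A cycle made of pieces of a given cycle C is coded by the list of the
   half-open intervals of positions that it visits; positions m = |C| and m + 1
   stand for two vertices off C. *)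
Definition block (b : nat * nat) : seq nat := iota b.1 (b.2 - b.1).

Lemma mem_block b t : (t \in block b) = (b.1 <= t < b.2).
Proof. by rewrite mem_iota; lia. Qed.

Lemma uniq_blocks (bs : seq (nat * nat)) :
  pairwise (fun b c => (b.2 <= c.1) || (c.2 <= b.1)) bs ->
  uniq (flatten (map block bs)).
Proof.
elim: bs => //= b bs IHbs /andP[b_bs /IHbs uniq_bs].
rewrite cat_uniq iota_uniq uniq_bs andbT /=.
suff dis (t : nat) : t \in flatten (map block bs) -> t \notin block b by apply/hasPn.
case/flattenP=> _ /mapP[[c1 c2] c_bs ->]; have := allP b_bs _ c_bs.
by rewrite !mem_block /=; lia.
Qed.

Lemma mem_blocks b bs t :
  (t \in flatten (map block (b :: bs))) = (b.1 <= t < b.2) || (t \in flatten (map block bs)).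
Proof. by rewrite /= mem_cat mem_block. Qed.

Lemma nth_blocks b bs p :
  nth 0 (flatten (map block (b :: bs))) p =
    if p < b.2 - b.1 then b.1 + p else nth 0 (flatten (map block bs)) (p - (b.2 - b.1)).
Proof. by rewrite /= nth_cat size_iota; case: ifP => // lt_p; rewrite nth_iota. Qed.

(** Sums of endpoints replace a sum of differences, so that the length of a coded cycle is a linear
    goal without truncated subtraction. *)
Lemma sum_blocks (bs : seq (nat * nat)) : all (fun b => b.1 <= b.2) bs ->
  \sum_(b <- bs) b.2 = size (flatten (map block bs)) + \sum_(b <- bs) b.1.
Proof.
move=> /allP ok; rewrite size_flatten /shape -map_comp sumnE big_map -big_split /=.
by apply: eq_big_seq => c /ok c_le; rewrite size_iota subnK.
Qed.

Section Blocks.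

Variables (T : Type) (e : rel T) (X : nat -> T).

Lemma path_block a j d :
  (forall t, a <= t < a + d -> e (X t) (X t.+1)) ->
  path e (X a) ([seq X t | t <- iota a.+1 d] ++ j) = path e (X (a + d)) j.
Proof.
elim: d a => [|d IHd] a arcs /=; first by rewrite addn0.
have -> : e (X a) (X a.+1) by apply: arcs; lia.
by rewrite IHd ?addSnnS // => t lt_t; apply: arcs; lia.
Qed.

(** Only the last position of [a] and the first of [x] matter; taking both to be the first block
    closes the cycle in [cycle_blocks]. *)
Lemma path_blocks a bs x :
  all (fun b => b.1 < b.2) bs ->
  (forall b : nat * nat, b \in bs -> forall t, b.1 <= t -> t.+1 < b.2 -> e (X t) (X t.+1)) ->
  path (fun b c => e (X b.2.-1) (X c.1)) a (rcons bs x) ->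
  path e (X a.2.-1) (rcons (map X (flatten (map block bs))) (X x.1)).
Proof.
elim: bs a => [|b bs IHbs] a //= /andP[b_ne bs_ne] arcs /andP[ab pbs].
have [d bE] : exists d, b.2 = (b.1 + d).+1 by exists (b.2.-1 - b.1); lia.
have -> : block b = b.1 :: iota b.1.+1 d.
  by rewrite /block bE subSn ?leq_addr // addKn.
rewrite /= ab /= map_cat rcons_cat path_block => [|t ?]; last first.
  by apply: (arcs b); rewrite ?mem_head; lia.
have := IHbs b bs_ne; rewrite {1}bE /=; apply => // c c_bs.
by apply: arcs; rewrite inE c_bs orbT.
Qed.

Lemma cycle_blocks bs :
  all (fun b => b.1 < b.2) bs ->
  (forall b : nat * nat, b \in bs -> forall t, b.1 <= t -> t.+1 < b.2 -> e (X t) (X t.+1)) ->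
  cycle (fun b c => e (X b.2.-1) (X c.1)) bs ->
  cycle e (map X (flatten (map block bs))).
Proof.
case: bs => //= b bs /andP[b_ne bs_ne] arcs pbs.
have [d bE] : exists d, b.2 = (b.1 + d).+1 by exists (b.2.-1 - b.1); lia.
have -> : block b = b.1 :: iota b.1.+1 d.
  by rewrite /block bE subSn ?leq_addr // addKn.
rewrite /= map_cat rcons_cat path_block => [|t ?]; last first.
  by apply: (arcs b); rewrite ?mem_head; lia.
have := @path_blocks b bs b bs_ne; rewrite {1}bE /=; apply => // c c_bs.
by apply: arcs; rewrite inE c_bs orbT.
Qed.

End Blocks.

(** * Extremal configurations and cycles through [z] *)

(* [extremal_cut] is 2-strength in a form that is invariant under arc reversal. *)
Record extremal (T : finType) (e : rel T) (z : T) (k m : nat) : Prop := Extremal {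
  extremal_irr : irreflexive e;
  extremal_cut : forall (v a b : T) (S : {set T}),
    v \notin S -> a \in S -> b \notin S -> b != v ->
    exists x y, [/\ x \in S, y \notin S, y != v & e x y];
  extremal_deg : forall x, x != z -> #|T| + k <= deg e x;
  extremal_degz : #|T| - k - 4 <= deg e z;
  extremal_gt1 : 1 < m;
  extremal_lt : m < #|T|;
  extremal_ge : #|T| - k - 2 <= m;
  extremal_max : forall s, ucycle e s -> z \in s -> size s <= m }.

(* [lia] becomes slow when it has to traverse hypotheses about arcs. *)
Ltac lia_nat := repeat match goal with H : ?P |- _ =>
    lazymatch P with
    | is_true (leq _ _) => fail
    | is_true (leq _ _ && leq _ _) => fail
    | is_true (~~ leq _ _) => fail
    | is_true (~~ (leq _ _ && leq _ _)) => fail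
    | is_true (_ != _) => fail
    | @eq nat _ _ => fail
    | nat => fail
    | _ => clear H
    end
  end; lia.

Ltac lia_bool := repeat match goal with
  | |- is_true true => exact: isT
  | |- is_true (_ && _) => apply/andP; split
  | |- is_true (_ || _) => first [by apply/orP; left; lia_nat | by apply/orP; right; lia_nat]
  | |- _ => lia_nat
  end.

Ltac nth_lia := repeat (case: ltnP => ?); lia_nat.

Section Extremal.

Variables (T : finType) (e : rel T) (z : T) (k m : nat).
Hypothesis Dex : extremal e z k m.

Let m_gt1 : 1 < m := extremal_gt1 Dex.
Let e_irr : irreflexive e := extremal_irr Dex.

(* [nth z s] is z at both 0 and m, which closes the cycle. *)
Definition zcycle s := [/\ ucycle e s, nth z s 0 = z & size s = m].

Lemma zcycle_last s : zcycle s -> nth z s m = z.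
Proof. by case=> _ _ <-; rewrite nth_default. Qed.

Lemma zcycle_uniq s : zcycle s -> uniq s.
Proof. by case=> /andP[]. Qed.

Lemma zcycle_arc s t : zcycle s -> t < m -> e (nth z s t) (nth z s t.+1).
Proof.
case=> /andP[cyc _] s0 sz; rewrite -sz; case: s cyc s0 {sz} => //= x s cyc xz lt_t.
subst x; have /(pathP z)/(_ t) := cyc; rewrite size_rcons => /(_ lt_t).
rewrite -rcons_cons !nth_rcons /= lt_t if_same.
by case: (ltnP t (size s)) => // le_t; rewrite [nth z s t]nth_default.
Qed.

(** The disjunction admits vertices of [ys] only as one-vertex blocks, since consecutive ones need
    not be joined by an arc. *)
Lemma zcycle_blocks s ys bs : zcycle s -> uniq (s ++ ys) ->
  all (fun b => [&& b.1 < b.2, b.2 <= m + size ys & (b.2 <= m) || (b.2 == b.1.+1)]) bs ->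
  pairwise (fun b c => (b.2 <= c.1) || (c.2 <= b.1)) bs ->
  cycle (fun b c => e (nth z (s ++ ys) b.2.-1) (nth z (s ++ ys) c.1)) bs ->
  ucycle e (map (nth z (s ++ ys)) (flatten (map block bs))).
Proof.
move=> sC Us /allP ok disj links; have sz : size s = m by case: sC.
apply/andP; split.
  apply: cycle_blocks => //; first by apply/allP => b /ok/andP[].
  move=> b /ok/and3P[_ _ bm] t le_t lt_t.
  have lt_tm : t.+1 < m by case/orP: bm => [|/eqP]; lia.
  by rewrite !nth_cat sz lt_tm (ltnW lt_tm); apply: zcycle_arc => //; apply: ltnW.
rewrite map_inj_in_uniq ?uniq_blocks // => t t'.
have lt_mem u : u \in flatten (map block bs) -> u < size (s ++ ys).
  case/flattenP=> _ /mapP[b /ok/and3P[_ b_le _] ->].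
  by rewrite mem_block size_cat sz; lia.
by move=> /lt_mem lt1 /lt_mem lt2 /eqP; rewrite nth_uniq // => /eqP.
Qed.

Lemma zcycle_blocks_size s ys bs : zcycle s -> uniq (s ++ ys) ->
  all (fun b => [&& b.1 < b.2, b.2 <= m + size ys & (b.2 <= m) || (b.2 == b.1.+1)]) bs ->
  pairwise (fun b c => (b.2 <= c.1) || (c.2 <= b.1)) bs ->
  cycle (fun b c => e (nth z (s ++ ys) b.2.-1) (nth z (s ++ ys) c.1)) bs ->
  has (fun b => b.1 == 0) bs ->
  \sum_(b <- bs) b.2 <= m + \sum_(b <- bs) b.1.
Proof.
move=> sC Us ok disj links /hasP[b b_bs /eqP b0].
have Uc := zcycle_blocks sC Us ok disj links.
rewrite sum_blocks; last by apply/allP => c /(allP ok)/and3P[/ltnW].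
rewrite leq_add2r -(size_map (nth z (s ++ ys))); apply: (extremal_max Dex Uc).
have [_ s0 sz] := sC; have /and3P[b_ne _ _] := allP ok b b_bs.
apply/mapP; exists 0; last by rewrite nth_cat sz; case: ifP => //; lia.
by apply/flattenP; exists (block b); [apply/mapP; exists b | rewrite mem_block b0; lia].
Qed.

Lemma zcycle_insert s y t : zcycle s -> y \notin s -> t < m ->
  e (nth z s t) y -> e y (nth z s t.+1) -> False.
Proof.
move=> sC ys lt_t ty yt; have [_ s0 sz] := sC.
have Us : uniq (s ++ [:: y]) by rewrite cats1 rcons_uniq ys (zcycle_uniq sC).
have XE u : u < m -> nth z (s ++ [:: y]) u = nth z s u by move=> lt_u; rewrite nth_cat sz lt_u.
have Xm : nth z (s ++ [:: y]) m = y by rewrite nth_cat sz ltnn subnn.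
have last_arc : e (nth z s m.-1) z.
  by have := @zcycle_arc s m.-1 sC; rewrite prednK ?zcycle_last //; [apply|]; lia.
have [ltm|gem] := ltnP t.+1 m.
  suff : t.+1 + (m.+1 + m) <= m + (m + t.+1) by lia.
  have := @zcycle_blocks_size s [:: y] [:: (0, t.+1); (m, m.+1); (t.+1, m)] sC Us.
  rewrite !big_cons !big_nil /= !add0n !addn0; apply=> //; [by lia_bool | by lia_bool |].
  by rewrite !Xm !(XE 0, XE t, XE t.+1, XE m.-1) ?s0 ?ty ?yt ?last_arc //; lia.
(* The successor of the last position is [z], so no final block remains. *)
have tm : t.+1 = m by lia.
suff : t.+1 + m.+1 <= m + m by lia.
have := @zcycle_blocks_size s [:: y] [:: (0, t.+1); (m, m.+1)] sC Us.
rewrite !big_cons !big_nil /= !add0n !addn0; apply=> //; [by lia_bool | by lia_bool |].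
move: yt; rewrite tm zcycle_last // => yz.
by rewrite !Xm !(XE 0, XE t) ?s0 ?ty ?yz //; lia.
Qed.

(** * Degree counting *)

(** Each summand groups the two arcs that inserting [w] after position [t] would use. The shift by
    one is harmless because position [m] is [z] again. *)
Lemma deg_zcycle s w : zcycle s ->
  deg e w = \sum_(0 <= t < m) (e (nth z s t) w + e w (nth z s t.+1))
            + \sum_(x | x \notin s) (e w x + e x w).
Proof.
move=> sC; have [_ s0 sz] := sC; have Us := zcycle_uniq sC.
have -> : deg e w = \sum_x (e w x + e x w).
  by rewrite big_split /deg /outdeg /indeg /= -!big_mkcond !sum1dep_card !cardsE.
rewrite (bigID (mem s)) /=; congr (_ + _).
rewrite -(big_uniq _ Us) (big_nth z) sz !big_split /= addnC; congr (_ + _).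
have [m' mE] : exists m', m = m'.+1 by exists m.-1; lia.
rewrite mE big_nat_recl // big_nat_recr //= -mE zcycle_last // s0.
by rewrite addnC.
Qed.

Lemma card_notin s : zcycle s -> #|[pred x | x \notin s]| = #|T| - m.
Proof.
move=> sC; have [_ _ <-] := sC; rewrite -(card_uniqP (zcycle_uniq sC)).
by rewrite -(cardC (mem s)) addKn; apply: eq_card => x.
Qed.

Lemma sum_gaps (f : nat -> nat) (ts : seq nat) : (forall t, t < m -> f t <= 1) ->
  uniq ts -> (forall t, t \in ts -> t < m /\ f t = 0) ->
  \sum_(0 <= t < m) f t + size ts <= m.
Proof.
move=> f1 Uts ts0.
have -> : size ts = \sum_(0 <= t < m) (t \in ts).
  have -> : \sum_(0 <= t < m) (t \in ts : nat) = size [seq t <- iota 0 m | t \in ts].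
    rewrite size_filter -sum1_count [RHS]big_mkcond /index_iota subn0.
    by apply: eq_bigr => t _; case: (t \in ts).
  apply/perm_size/uniq_perm; rewrite ?filter_uniq ?iota_uniq // => t.
  by rewrite mem_filter mem_iota; case: (boolP (t \in ts)) => // /ts0[-> _].
rewrite -big_split /= -[X in _ <= X]muln1 -[m in X in _ <= X]subn0 -[X in _ <= X]sum_nat_const_nat.
rewrite !big_nat; apply: leq_sum => t /andP[_ lt_t].
have [/ts0[_ ->]|_] := boolP (t \in ts); rewrite ?addn0 //; exact: f1.
Qed.

(** By [zcycle_insert], [y] has at most [m] arcs to and from the cycle, and at most [2(r - 1)] to
    and from the other outside vertices, where [r = #|T| - m]. The degree bound then gives
    [m <= #|T| - k - 2], so all these estimates are tight. *)
Lemma outside_deg s y : zcycle s -> y \notin s ->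
  [/\ #|T| = m + k + 2,
      forall t, t < m -> e y (nth z s t.+1) = ~~ e (nth z s t) y &
      forall y', y' \notin s -> y != y' -> e y y'].
Proof.
move=> sC ys; have [_ s0 sz] := sC.
have yz : y != z by apply: contraNneq ys => ->; rewrite -s0 mem_nth //; lia.
have := extremal_deg Dex yz; rewrite (deg_zcycle y sC).
pose f := fun t => e (nth z s t) y + e y (nth z s t.+1) : nat.
set S := \sum_(x | _) _; set F := \sum_(0 <= t < m) _.
have FE : F = \sum_(0 <= t < m) f t by [].
have f1 t : t < m -> f t <= 1.
  move=> lt_t; rewrite /f; have [ty|_] := boolP (e (nth z s t) y); last by case: (e y _).
  by have [yt|//] := boolP (e y (nth z s t.+1)); case: (zcycle_insert sC ys lt_t ty yt).
have := card_notin sC; set r := #|T| - m => cr.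
have r2 : \sum_(x | x \notin s) 2 = r * 2.
  by rewrite -cr -sum_nat_const; apply: eq_bigl => x; rewrite inE.
have S_le (y' : T) : y' \notin s -> y != y' -> ~~ (e y y') -> S + 3 <= r * 2.
  move=> ys' yy' nyy'; rewrite -r2 /S (bigD1 y) //= e_irr add0n.
  rewrite (bigD1 y') /= ?ys' 1?eq_sym // (negbTE nyy') add0n.
  rewrite [X in _ <= X](bigD1 y) //= [X in _ <= _ + X](bigD1 y') /= ?ys' 1?eq_sym //.
  set A := \sum_(i | _) _; set B := \sum_(i | _) _; have : A <= B.
    by apply: leq_sum => x _; case: (e _ _); case: (e _ _).
  by case: (e y' y); lia.
have S_le2 : S + 2 <= r * 2.
  rewrite -r2 /S (bigD1 y) //= e_irr add0n.
  rewrite [X in _ <= X](bigD1 y) //=.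
  set A := \sum_(i | _) _; set B := \sum_(i | _) _; have : A <= B.
    by apply: leq_sum => x _; case: (e _ _); case: (e _ _).
  by lia.
have F_le : F <= m.
  by have := @sum_gaps f [::] f1 isT; rewrite addn0 FE; apply.
have := extremal_ge Dex; have := extremal_lt Dex => lt_m ge_m deg_y.
have nE : #|T| = m + k + 2 by lia.
split=> // [t lt_t|y' ys' yy'].
  have := f1 t lt_t.
  have : f t != 0.
    apply/eqP => ft0; have := @sum_gaps f [:: t] f1 isT.
    have ts0 u : u \in [:: t] -> u < m /\ f u = 0 by rewrite inE => /eqP->.
    by move/(_ ts0) => /=; rewrite -FE; lia.
  by rewrite /f; case: (e _ _); case: (e _ _).
by apply: contraT => /(S_le _ ys' yy'); lia.
Qed.

Lemma outside_two s : zcycle s -> exists y y', [/\ y \notin s, y' \notin s & y != y'].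
Proof.
move=> sC; have lt_m := extremal_lt Dex; have cr := card_notin sC.
have /card_gt0P[y ys] : 0 < #|[pred x | x \notin s]| by lia.
have [nE _ _] := outside_deg sC ys.
have /card_gt1P[u [v [us vs uv]]] : 1 < #|[pred x | x \notin s]| by lia.
by exists u, v.
Qed.

(** * The pivot *)

Lemma zcycle_extend s y y' : zcycle s -> y \notin s -> y' \notin s -> y != y' ->
  exists X : nat -> T,
  [/\ forall t, t < m -> X t = nth z s t, X m = y, X m.+1 = y',
      e (X m) (X m.+1) & e (X m.-1) (X 0)] /\
  {in [pred t | t < m + 2] &, injective X} /\
  forall bs,
    all (fun b => [&& b.1 < b.2, b.2 <= m + 2 & (b.2 <= m) || (b.2 == b.1.+1)]) bs ->
    pairwise (fun b c => (b.2 <= c.1) || (c.2 <= b.1)) bs ->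
    cycle (fun b c => e (X b.2.-1) (X c.1)) bs ->
    has (fun b => b.1 == 0) bs ->
    ucycle e (map X (flatten (map block bs))) /\
    \sum_(b <- bs) b.2 <= m + \sum_(b <- bs) b.1.
Proof.
move=> sC ys ys' yy'; have [_ s0 sz] := sC.
have Us : uniq (s ++ [:: y; y']).
  by rewrite cat_uniq (zcycle_uniq sC) /= orbF negb_or ys ys' inE yy'.
exists (nth z (s ++ [:: y; y'])); split; last first.
  split=> [t t'|bs]; rewrite ?inE.
    by move=> lt_t lt_t' /eqP; rewrite nth_uniq ?size_cat ?sz // => /eqP.
  move=> ok disj links has0; split; first exact: (zcycle_blocks sC Us ok disj links).
  exact: (zcycle_blocks_size sC Us ok disj links has0).
have XE t : t < m -> nth z (s ++ [:: y; y']) t = nth z s t by move=> lt_t; rewrite nth_cat sz lt_t.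
have Xm : nth z (s ++ [:: y; y']) m = y by rewrite nth_cat sz ltnn subnn.
have Xm1 : nth z (s ++ [:: y; y']) m.+1 = y' by rewrite nth_cat sz ltnNge leqnSn subSnn.
have m_gt0 : 0 < m by lia.
split=> //; first by rewrite Xm Xm1; have [_ _] := outside_deg sC ys; apply.
have lt_m1 : m.-1 < m by lia.
by rewrite !XE // s0; have := zcycle_arc sC lt_m1; rewrite prednK // zcycle_last.
Qed.

(** The detour gains two vertices and skips at most one; [q = m] means a return to [z]. *)
Lemma zcycle_detour s y y' t q : zcycle s -> y \notin s -> y' \notin s -> y != y' ->
  t < q -> q <= t + 2 -> q <= m -> e (nth z s t) y -> e y' (nth z s q) -> False.
Proof.
move=> sC ys ys' yy' lt_tq le_qt le_qm + y'q; have [_ s0 _] := sC.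
have [X [[XE <- Xm1 mm last_arc] [_ cyc]]] := zcycle_extend sC ys ys' yy'.
rewrite -XE ?(leq_trans lt_tq) // => ty.
move: y'q; rewrite -Xm1; have [ltm|gem] := ltnP q m.
  rewrite -XE // => mq.
  have [/=|/=|/=|//|_] := cyc [:: (0, t.+1); (m, m.+1); (m.+1, m.+2); (q, m)].
  - by lia_bool.
  - by lia_bool.
  - by rewrite ty mq mm last_arc.
  by rewrite !big_cons !big_nil /=; lia_nat.
have -> : q = m by lia.
rewrite zcycle_last // -{1}s0 -XE // => [mz|]; last by lia.
have [/=|/=|/=|//|_] := cyc [:: (0, t.+1); (m, m.+1); (m.+1, m.+2)].
- by lia_bool.
- by lia_bool.
- by rewrite ty mz mm.
by rewrite !big_cons !big_nil /=; lia_nat.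
Qed.

Definition pivot s l :=
  [/\ 0 < l < m,
      forall y t, y \notin s -> t < m -> e y (nth z s t) = (0 < t <= l) &
      forall y t, y \notin s -> t < m -> e (nth z s t) y = (l <= t)].

(** Detours that skip nothing show that all outside vertices have the same in-neighbours on [s];
    detours that skip one vertex show that these positions are closed upwards. Two cuts make them a
    nonempty proper final segment, and [alt] determines the out-neighbours. *)
Lemma pivot_exists s : zcycle s -> exists l, pivot s l.
Proof.
move=> sC; have [_ s0 sz] := sC; have [y [y' [ys ys' yy']]] := outside_two sC.
have alt u t : u \notin s -> t < m -> e u (nth z s t.+1) = ~~ e (nth z s t) u.
  by move=> us; have [_ + _] := outside_deg sC us; apply.
have same u v t : u \notin s -> v \notin s -> t < m -> e (nth z s t) u -> e (nth z s t) v.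
  move=> us vs lt_t tu; have [<-//|uv] := eqVneq u v.
  apply: contraT; rewrite -(alt v) // => tv.
  by case: (zcycle_detour sC us vs uv _ _ _ tu tv); lia_nat.
have mono u t : u \notin s -> t.+1 < m -> e (nth z s t) u -> e (nth z s t.+1) u.
  move=> us lt_t tu.
  have [v vs uv] : exists2 v, v \notin s & u != v.
    have [<-|] := eqVneq y u; first by exists y'.
    by exists y; rewrite // eq_sym.
  apply: contraT => ntu; have : e v (nth z s t.+2).
    by rewrite alt //; apply: contra ntu; apply: same.
  by move=> tv; case: (zcycle_detour sC us vs uv _ _ _ tu tv); lia_nat.
have mono_le u a b : u \notin s -> a <= b -> b < m -> e (nth z s a) u -> e (nth z s b) u.
  move=> us; elim: b => [|b IHb]; first by rewrite leqn0 => /eqP->.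
  by rewrite leq_eqVlt => /predU1P[->//|ab] lt_b au; apply: mono => //; apply: IHb => //; lia.
have Rin x : x \in s -> exists2 t, t < m & x = nth z s t.
  by move=> xs; exists (index x s); rewrite ?nth_index // -sz index_mem.
have zs : z \in s by rewrite -{1}s0 mem_nth // sz; lia.
have leave : exists2 t, t < m & ~~ e (nth z s t) y.
  have /(_ [set x | x \notin s]) := @extremal_cut _ _ _ _ _ Dex z y (nth z s 1).
  case; rewrite ?inE ?negbK ?mem_nth ?sz //.
    by rewrite -[X in _ != X]s0 nth_uniq ?sz ?(zcycle_uniq sC) //; lia.
  move=> u [v []]; rewrite !inE negbK => us /Rin[[|t] lt_t ->].
    by rewrite s0 eqxx.
  rewrite alt // => [|]; last lia.
  by move=> _ ntu; exists t; [lia | apply: contra ntu; apply: same => //; lia].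
have enter : exists2 t, t < m & e (nth z s t) y.
  have /(_ [set x | x \in s]) := @extremal_cut _ _ _ _ _ Dex y' z y.
  case; rewrite ?inE //.
  move=> u [v []]; rewrite !inE => /Rin[t lt_t ->] vs _ tv.
  by exists t => //; apply: same tv.
have P0 : exists t, (t < m) && e (nth z s t) y by case: enter => t ? ?; exists t; apply/andP.
case: (ex_minnP P0) => l /andP[lt_l ly] minl.
have inE' u t : u \notin s -> t < m -> e (nth z s t) u = (l <= t).
  move=> us lt_t; apply/idP/idP => [tu|le_t].
    by apply: minl; rewrite lt_t; apply: same tu.
  by apply: (@same y) => //; apply: mono_le ly.
have l_gt0 : 0 < l.
  rewrite lt0n; apply/eqP => l0; case: leave => t lt_t; rewrite inE' //; lia.
exists l; split; [by rewrite l_gt0 | | by []].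
move=> u [|t] us lt_t; last first.
  have lt_t' : t < m by lia.
  by rewrite alt // inE' // -ltnNge.
(* Position 0 succeeds position [m - 1], whose arc to [u] excludes the arc from [u] to [z]. *)
have lt_m1 : m.-1 < m by lia.
by rewrite s0 -(zcycle_last sC) -(prednK (ltnW m_gt1)) alt // inE' //; lia.
Qed.

(** * Arcs forbidden by longer cycles *)

Ltac link_arcs out0 out1 in0 in1 := repeat match goal with
  | |- is_true true => exact: isT
  | |- is_true (_ && _) => apply/andP; split
  | |- _ => first [assumption | apply: out0; lia_nat | apply: out1; lia_nat
                  | apply: in0; lia_nat | apply: in1; lia_nat]
  end.

(** Maximality is put in refutation form, so that an arc is forbidden by exhibiting a list of
    blocks. *)
Lemma pivot_extend s l : zcycle s -> pivot s l -> exists X : nat -> T,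
  [/\ forall t, t < m -> nth z s t = X t,
      [/\ forall t, 0 < t <= l -> e (X m) (X t), forall t, 0 < t <= l -> e (X m.+1) (X t),
          forall t, l <= t < m -> e (X t) (X m) & forall t, l <= t < m -> e (X t) (X m.+1)],
      e (X m) (X m.+1) /\ e (X m.-1) (X 0), z = X 0 &
      forall bs,
      all (fun b => [&& b.1 < b.2, b.2 <= m + 2 & (b.2 <= m) || (b.2 == b.1.+1)]) bs ->
      pairwise (fun b c => (b.2 <= c.1) || (c.2 <= b.1)) bs ->
      cycle (fun b c => e (X b.2.-1) (X c.1)) bs ->
      has (fun b => b.1 == 0) bs ->
      m + \sum_(b <- bs) b.1 < \sum_(b <- bs) b.2 -> False].
Proof.
move=> sC piv; have [/andP[l_gt0 lt_l] outR inR] := piv; have [_ s0 _] := sC.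
have [y [y' [ys ys' yy']]] := outside_two sC.
have [X [[XE Xm Xm1 mm last_arc] [_ cyc]]] := zcycle_extend sC ys ys' yy'; exists X.
split=> //; first by move=> t /XE.
- by split=> t t_l; rewrite ?Xm ?Xm1 XE ?outR ?inR //; lia.
- by rewrite XE ?s0 //; lia.
move=> bs ok disj links has0; rewrite ltnNge => /negP; apply.
by have [_] := cyc bs ok disj links has0.
Qed.

(** The cycle [z, x_j .. x_{m-1}, y, y', x_1 .. x_i] skips at most one vertex and gains two. *)
Lemma z_passage s l i j : zcycle s -> pivot s l ->
  0 < i -> i < j -> j < m -> j <= i + 2 -> e (nth z s i) z -> e z (nth z s j) -> False.
Proof.
move=> sC piv; have [/andP[l_gt0 lt_l] _ _] := piv.
have [X [XE [out0 out1 in0 in1] [mm last_arc] zX no_cycle]] := pivot_extend sC piv.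
move=> i_gt0 lt_ij lt_j le_j; rewrite !XE ?zX ?(ltn_trans lt_ij) // => iz zj.
apply: (no_cycle [:: (0, 1); (j, m); (m, m.+1); (m.+1, m.+2); (1, i.+1)]) => //=.
- by lia_bool.
- by lia_bool.
- by link_arcs out0 out1 in0 in1.
by rewrite !big_cons !big_nil /=; lia_nat.
Qed.

(** The cycle [z, x_j .. x_{m-1}, y, x_{i+1} .. x_{j-1}, y', x_1 .. x_i] skips nothing; its middle
    piece contains the pivot, so [y] can enter it and [y'] can leave it. *)
Lemma z_not_across s l i j : zcycle s -> pivot s l ->
  0 < i -> i < l -> l < j -> j < m -> e (nth z s i) z -> e z (nth z s j) -> False.
Proof.
move=> sC piv; have [/andP[l_gt0 lt_l] _ _] := piv.
have [X [XE [out0 out1 in0 in1] [mm last_arc] zX no_cycle]] := pivot_extend sC piv.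
move=> i_gt0 lt_il lt_lj lt_j; rewrite !XE ?zX ?(ltn_trans lt_il) // => iz zj.
apply: (no_cycle [:: (0, 1); (j, m); (m, m.+1); (i.+1, j); (m.+1, m.+2); (1, i.+1)]) => //=.
- by lia_bool.
- by lia_bool.
- by link_arcs out0 out1 in0 in1.
by rewrite !big_cons !big_nil /=; lia_nat.
Qed.

Definition crossing s l i j :=
  [&& 0 < i, i < l, l < j, j < m & e (nth z s i) (nth z s j)].

(** The cycle [z .. x_p, x_t .. x_{j-1}, y, y', x_{p+1} .. x_i, x_j .. x_{m-1}] skips only the
    positions strictly between [i] and [t]. *)
Lemma crossing_src s l i j p t : zcycle s -> pivot s l ->
  crossing s l i j ->
  p < i -> i < t -> t < j -> t <= i + 2 -> e (nth z s p) (nth z s t) -> False.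
Proof.
move=> sC piv; have [/andP[l_gt0 lt_l] _ _] := piv.
have [X [XE [out0 out1 in0 in1] [mm last_arc] zX no_cycle]] := pivot_extend sC piv.
case/and5P=> i_gt0 lt_il lt_lj lt_j; have lt_i : i < m by lia_nat.
rewrite (XE i) // (XE j) // => ij lt_pi lt_it lt_tj le_t.
have [lt_p lt_t] : p < m /\ t < m by split; lia_nat.
rewrite !XE // => pt.
apply: (no_cycle [:: (0, p.+1); (t, j); (m, m.+1); (m.+1, m.+2); (p.+1, i.+1); (j, m)]) => //=.
- by lia_bool.
- by lia_bool.
- by link_arcs out0 out1 in0 in1.
by rewrite !big_cons !big_nil /=; lia_nat.
Qed.

(** Mirror image of [crossing_src] under arc reversal. *)
Lemma crossing_dst s l i j t q : zcycle s -> pivot s l ->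
  crossing s l i j ->
  i < t -> t < j -> j <= t + 2 -> j < q -> q < m -> e (nth z s t) (nth z s q) -> False.
Proof.
move=> sC piv; have [/andP[l_gt0 lt_l] _ _] := piv.
have [X [XE [out0 out1 in0 in1] [mm last_arc] zX no_cycle]] := pivot_extend sC piv.
case/and5P=> i_gt0 lt_il lt_lj lt_j; have lt_i : i < m by lia_nat.
rewrite (XE i) // (XE j) // => ij lt_it lt_tj le_j lt_jq lt_q.
have lt_t : t < m by lia_nat.
rewrite !XE // => tq.
apply: (no_cycle [:: (0, i.+1); (j, q); (m, m.+1); (m.+1, m.+2); (i.+1, t.+1); (q, m)]) => //=.
- by lia_bool.
- by lia_bool.
- by link_arcs out0 out1 in0 in1.
by rewrite !big_cons !big_nil /=; lia_nat.
Qed.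

(** The analogue of [crossing_dst] for [q = m], where position [m] is [z]. *)
Lemma crossing_dst_z s l i j t : zcycle s -> pivot s l ->
  crossing s l i j ->
  i < t -> t < j -> j <= t + 2 -> e (nth z s t) z -> False.
Proof.
move=> sC piv; have [/andP[l_gt0 lt_l] _ _] := piv.
have [X [XE [out0 out1 in0 in1] [mm last_arc] zX no_cycle]] := pivot_extend sC piv.
case/and5P=> i_gt0 lt_il lt_lj lt_j; have lt_i : i < m by lia_nat.
rewrite (XE i) // (XE j) // => ij lt_it lt_tj le_j.
have lt_t : t < m by lia_nat.
rewrite XE // zX => tz.
apply: (no_cycle [:: (0, i.+1); (j, m); (m, m.+1); (m.+1, m.+2); (i.+1, t.+1)]) => //=.
- by lia_bool.
- by lia_bool.
- by link_arcs out0 out1 in0 in1.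
by rewrite !big_cons !big_nil /=; lia_nat.
Qed.

(** All arcs at [z] go to or come from the cycle, and each gap carries at most one, by [z_passage]
    or, at the two ends, by the absence of loops. As [z] has degree at least [m - 2], at most two
    gaps are empty. *)
Lemma z_gaps s l t1 t2 t3 : zcycle s -> pivot s l ->
  0 < t1 -> t1 < t2 -> t2 < t3 -> t3.+1 < m ->
  (forall t, t \in [:: t1; t2; t3] -> ~~ e (nth z s t) z && ~~ e z (nth z s t.+1)) -> False.
Proof.
move=> sC piv t1_gt0 lt12 lt23 lt3 ts0; have [_ s0 sz] := sC.
have [y [y' [ys ys' yy']]] := outside_two sC; have [nE _ _] := outside_deg sC ys.
have [/andP[l_gt0 lt_l] outR inR] := piv.
have m_gt0 : 0 < m by lia_nat.
have zR : \sum_(x | x \notin s) (e z x + e x z) = 0.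
  by apply: big1 => x xs; rewrite -s0 outR // inR // leqn0 eqn0Ngt l_gt0.
have := extremal_degz Dex; rewrite nE (deg_zcycle z sC) zR addn0.
pose f t := e (nth z s t) z + e z (nth z s t.+1).
have f1 t : t < m -> f t <= 1.
  move=> lt_t; rewrite /f; case: t lt_t => [|t] lt_t; first by rewrite s0 e_irr; case: (e _ _).
  have [lt_m|ge_m] := ltnP t.+2 m.
    have [tz|_] := boolP (e (nth z s t.+1) z); last by case: (e z _).
    have [zt|//] := boolP (e z (nth z s t.+2)).
    by case: (z_passage sC piv _ _ lt_m _ tz zt); lia.
  have -> : t.+2 = m by lia.
  by rewrite zcycle_last // e_irr; case: (e _ _).
have ts_f t : t \in [:: t1; t2; t3] -> t < m /\ f t = 0.
  move=> t_ts; split; first by move: t_ts; rewrite !inE => /or3P[] /eqP->; lia_nat.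
  by have := ts0 t t_ts; rewrite /f; case: (e _ _); case: (e _ _).
have Uts : uniq [:: t1; t2; t3] by rewrite /= !inE; lia.
by have := sum_gaps f1 Uts ts_f; rewrite /f /=; set F := \sum_(_ <= _ < _) _; lia_nat.
Qed.

(** * Cuts and reroutings in terms of positions *)

(* Position m stands for all the vertices off the cycle at once. *)
Lemma zcycle_cut s l v (P : pred nat) a b : zcycle s -> pivot s l ->
  v < m -> ~~ P v -> a <= m -> P a -> b <= m -> ~~ P b -> b != v ->
  exists i j, [/\ i <= m, j <= m, P i, ~~ P j & j != v] /\
    [\/ [/\ i < m, j < m & e (nth z s i) (nth z s j)],
        i = m /\ 0 < j <= l | j = m /\ l <= i].
Proof.
move=> sC piv lt_v nPv le_a Pa le_b nPb bv; have [_ outR inR] := piv.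
have [y [y' [ys ys' yy']]] := outside_two sC; have [_ s0 sz] := sC.
(* [index] takes the value [size s], that is [m], at every vertex off [s]. *)
have idx t : t <= m -> exists x, index x s = t.
  rewrite leq_eqVlt => /predU1P[->|lt_t].
    by exists y; rewrite -sz; apply/eqP; rewrite eqn_leq index_size leqNgt index_mem.
  by exists (nth z s t); rewrite index_uniq ?sz ?(zcycle_uniq sC).
have [xa xaE] := idx a le_a; have [xb xbE] := idx b le_b.
have vE : index (nth z s v) s = v by rewrite index_uniq ?sz ?(zcycle_uniq sC).
have := @extremal_cut _ _ _ _ _ Dex (nth z s v) xa xb [set x | P (index x s)].
rewrite !inE xaE xbE vE; case=> //.
  by apply: contraNneq bv => xbv; rewrite -xbE xbv vE.
move=> u [w []]; rewrite !inE => Pu nPw wv uw.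
have le x : index x s <= m by rewrite -sz index_size.
exists (index u s), (index w s); split.
  split=> //; apply: contraNneq wv => wv; rewrite -wv nth_index // -index_mem wv sz //.
have [us|us] := boolP (u \in s); have [ws|ws] := boolP (w \in s).
- by constructor 1; rewrite -sz !index_mem !nth_index.
- constructor 3; have wm : index w s = m.
    by apply/eqP; rewrite eqn_leq le /= -sz leqNgt index_mem.
  split=> //; have lt_u : index u s < m by rewrite -sz index_mem.
  by rewrite -(inR _ _ ws lt_u) nth_index.
- constructor 2; have um : index u s = m.
    by apply/eqP; rewrite eqn_leq le /= -sz leqNgt index_mem.
  split=> //; have lt_w : index w s < m by rewrite -sz index_mem.
  by rewrite -(outR _ _ us lt_w) nth_index.
have um x : x \notin s -> index x s = m.
  by move=> xs; apply/eqP; rewrite eqn_leq le /= -sz leqNgt index_mem.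
by move: nPw; rewrite um // -(um u) // Pu.
Qed.

(** Blocks of total length [m] give another longest cycle through [z], which has a pivot in turn.
    The links are required for every suitable [X] because the two outside vertices are chosen inside
    the proof. *)
Lemma reroute s l bs : zcycle s -> pivot s l ->
  let link X b c := e (X b.2.-1) (X c.1) : bool in
  all (fun b => [&& b.1 < b.2, b.2 <= m + 2 & (b.2 <= m) || (b.2 == b.1.+1)]) bs ->
  pairwise (fun b c => (b.2 <= c.1) || (c.2 <= b.1)) bs ->
  (head (1, 1) bs).1 = 0 ->
  \sum_(b <- bs) b.2 = m + \sum_(b <- bs) b.1 ->
  (forall X : nat -> T,
    (forall t, t < m -> X t = nth z s t) -> z = X 0 ->
    (forall t, 0 < t <= l -> e (X m) (X t)) -> (forall t, 0 < t <= l -> e (X m.+1) (X t)) ->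
    (forall t, l <= t < m -> e (X t) (X m)) -> (forall t, l <= t < m -> e (X t) (X m.+1)) ->
    e (X m) (X m.+1) -> e (X m.-1) (X 0) -> cycle (link X) bs) ->
  let ns := flatten (map block bs) in
  exists s', exists X : nat -> T,
  [/\ zcycle s', forall p, p < m -> nth z s' p = X (nth 0 ns p),
      forall t, t < m -> X t = nth z s t,
      forall t, t < m -> t \notin ns -> nth z s t \notin s' &
      X m \notin s /\ X m.+1 \notin s].
Proof.
move=> sC piv link ok disj h0 sum_eq links ns; have [/andP[l_gt0 lt_l] outR inR] := piv.
have [_ s0 sz] := sC; have [y [y' [ys ys' yy']]] := outside_two sC.
have [X [[XE Xm Xm1 mm last_arc] [injX cyc]]] := zcycle_extend sC ys ys' yy'.
have X0 : X 0 = z by rewrite XE //; lia_nat.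
have has0 : has (fun b => b.1 == 0) bs by case: (bs) h0 => //= b bs' ->.
have ns_lt t : t \in ns -> t < m + 2.
  case/flattenP=> _ /mapP[b /(allP ok)/and3P[_ b_le _] ->].
  by rewrite mem_block => /andP[_ lt_t]; apply: leq_trans lt_t b_le.
have [|Uc _] := cyc bs ok disj _ has0.
  apply: links => //; first by move=> t t_l; rewrite Xm XE ?outR //; lia_nat.
  - by move=> t t_l; rewrite Xm1 XE ?outR //; lia_nat.
  - by move=> t t_l; rewrite Xm XE ?inR //; lia_nat.
  by move=> t t_l; rewrite Xm1 XE ?inR //; lia_nat.
have size_ns : size ns = m.
  apply: (@addIn (\sum_(b <- bs) b.1)); rewrite -sum_eq.
  by rewrite sum_blocks //; apply/allP => c /(allP ok)/and3P[/ltnW].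
exists (map X ns), X; split=> //.
- split; rewrite ?size_map //.
  rewrite (nth_map 0) ?size_ns; last by lia_nat.
  rewrite -[RHS]X0; congr X; rewrite /ns; case: (bs) h0 ok => //= b bs' b0 /andP[/andP[b_ne _] _].
  by rewrite /block b0 subn0; case: (b.2) b_ne => //; rewrite b0.
- by move=> p lt_p; rewrite (nth_map 0) ?size_ns.
- move=> t lt_t t_ns; rewrite -XE //; apply: contra t_ns => /mapP[u u_ns /injX->] //; rewrite inE.
    by lia_nat.
  exact: ns_lt.
by rewrite Xm Xm1.
Qed.

(** The new cycle is [z .. x_i, x_{t+3} .. x_{m-1}, y, y', x_{i+1} .. x_t]; [y] is preceded by
    [(i + 1) + (m - t - 3)] vertices. *)
Lemma crossing_reroute s l i t : zcycle s -> pivot s l ->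
  crossing s l i t.+3 -> i < t -> e (nth z s t) z ->
  let P := i + m - (t + 2) in
  exists s' y y',
  [/\ zcycle s', y \notin s /\ y' \notin s, nth z s' P = y, nth z s' P.+1 = y' &
      [/\ nth z s t.+1 \notin s', nth z s t.+2 \notin s' &
         forall p, P.+1 < p < m -> nth z s' p = nth z s (p + t + 1 - m)]].
Proof.
move=> sC piv /and5P[i_gt0 lt_il lt_lj lt_j ij] lt_it tz P.
have [/andP[l_gt0 lt_l] outR inR] := piv.
pose bs := [:: (0, i.+1); (t.+3, m); (m, m.+1); (m.+1, m.+2); (i.+1, t.+1)].
have [/=|/=|//|||] := @reroute s l bs sC piv.
- by lia_bool.
- by lia_bool.
- by rewrite !big_cons !big_nil /=; lia_nat.
- move=> X XE zX out0 out1 in0 in1 mm last_arc /=.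
  have ij' : e (X i) (X t.+3) by rewrite !XE //; lia_nat.
  have tz' : e (X t) (X 0) by rewrite -zX XE //; lia_nat.
  by link_arcs out0 out1 in0 in1.
move=> s' [X [sC' nthE XE notin [ys ys']]].
have notin_bs u : t < u < t.+3 -> u \notin flatten (map block bs).
  by move=> u_t; rewrite !mem_blocks /= in_nil; lia_nat.
exists s', (X m), (X m.+1); split=> //.
- by rewrite nthE; [congr X; rewrite !nth_blocks /=; nth_lia | lia_nat].
- by rewrite nthE; [congr X; rewrite !nth_blocks /=; nth_lia | lia_nat].
split; [by apply: notin; [lia_nat | apply: notin_bs; lia_nat] .. |].
move=> p lt_p; rewrite -XE; last by lia_nat.
by rewrite nthE; [congr X; rewrite !nth_blocks /=; nth_lia | lia_nat].
Qed.

(** The new cycle is [z, x_{t+3} .. x_{m-1}, y, y', x_1 .. x_t]. *)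
Lemma passage_reroute s l t : zcycle s -> pivot s l ->
  0 < t -> t.+3 < m -> e (nth z s t) z -> e z (nth z s t.+3) ->
  exists s' y,
  [/\ zcycle s', y \notin s & nth z s' (m - t - 2) = y] /\
  [/\ nth z s t.+1 \notin s', nth z s t.+2 \notin s' &
       forall p, 0 < p < m - t - 2 -> nth z s' p = nth z s (p + t + 2)].
Proof.
move=> sC piv t_gt0 lt_t tz zt; have [/andP[l_gt0 lt_l] outR inR] := piv.
pose bs := [:: (0, 1); (t.+3, m); (m, m.+1); (m.+1, m.+2); (1, t.+1)].
have [/=|/=|//|||] := @reroute s l bs sC piv.
- by lia_bool.
- by lia_bool.
- by rewrite !big_cons !big_nil /=; lia_nat.
- move=> X XE zX out0 out1 in0 in1 mm last_arc /=.
  have zt' : e (X 0) (X t.+3) by rewrite -zX XE //; lia_nat.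
  have tz' : e (X t) (X 0) by rewrite -zX XE //; lia_nat.
  by link_arcs out0 out1 in0 in1.
move=> s' [X [sC' nthE XE notin [ys ys']]].
have notin_bs u : t < u < t.+3 -> u \notin flatten (map block bs).
  by move=> u_t; rewrite !mem_blocks /= in_nil; lia_nat.
exists s', (X m); split; split=> //.
- by rewrite nthE; [congr X; rewrite !nth_blocks /=; nth_lia | lia_nat].
- by apply: notin; [lia_nat | apply: notin_bs; lia_nat].
- by apply: notin; [lia_nat | apply: notin_bs; lia_nat].
move=> p lt_p; rewrite -XE; last by lia_nat.
by rewrite nthE; [congr X; rewrite !nth_blocks /=; nth_lia | lia_nat].
Qed.

(** * Consequences of strength near the pivot *)

(** Otherwise [x_l] would be the only out-neighbour, or the only in-neighbour, on the cycle of the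
    outside vertices, and deleting it would cut them off. *)
Lemma pivot_bounds s l : zcycle s -> pivot s l -> 1 < l /\ l.+1 < m.
Proof.
move=> sC piv; have [/andP[l_gt0 lt_l] _ _] := piv; split.
  have [|||||||i [j [[le_i le_j /eqP-> jm jl]]]] :=
    @zcycle_cut s l l (pred1 m) m 0 sC piv; rewrite /= ?eqxx //; try by lia_nat.
  case=> [[lt_i _ _] | [_ j_l] | [jE _]]; first by rewrite ltnn in lt_i.
    by move/eqP: jl; lia.
  by rewrite /= jE eqxx in jm.
have [|||||||i [j [[le_i le_j /andP[/eqP im /eqP il] jn jl]]]] :=
    @zcycle_cut s l l (fun t => (t != m) && (t != l)) 0 m sC piv; rewrite /= ?eqxx ?andbF //; try by lia.
have jE : j = m by apply/eqP; move: jn; rewrite negb_and !negbK (negbTE jl) orbF.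
by case=> [[_ lt_j _] | [iE _] | [_ le_li]]; lia.
Qed.

(** In [D - x_l] some arc leaves the positions below [l] taken with the outside, which sends arcs
    only to positions up to [l]. The hypothesis decides on which side [z] is put, so that the arc
    avoids [z]. *)
Lemma crossing_exists s l : zcycle s -> pivot s l ->
  (forall t, l < t < m -> ~~ e z (nth z s t)) \/ (forall t, 0 < t < l -> ~~ e (nth z s t) z) ->
  exists i j, crossing s l i j.
Proof.
move=> sC piv zLU; have [l_gt1 lt_l] := pivot_bounds sC piv; have [_ s0 _] := sC.
case: zLU => [zU|zL].
  have [|||||||i [j [[le_i le_j Pi nPj jl]]]] :=
    @zcycle_cut s l l (fun t => (t < l) || (t == m)) 0 l.+1 sC piv; rewrite /= ?ltnn //; try by lia.
  case=> [[lt_i lt_j ij] | [iE j_l] | [jE _]]; [|lia|lia].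
  exists i, j; rewrite /crossing ij lt_j; case: i lt_i le_i Pi ij => [|i] lt_i le_i Pi ij; last by lia.
  by have := zU j; rewrite -{1}s0 ij; lia.
have [|||||||i [j [[le_i le_j Pi nPj jl]]]] :=
    @zcycle_cut s l l (fun t => (0 < t < l) || (t == m)) 1 0 sC piv; rewrite /= ?ltnn //; try by lia.
case=> [[lt_i lt_j ij] | [iE j_l] | [jE _]]; [|lia|lia].
exists i, j; rewrite /crossing ij lt_j; case: j lt_j le_j nPj jl ij => [|j] lt_j le_j nPj jl ij; last by lia.
by have := zL i; rewrite -[X in e _ X]s0 ij; lia.
Qed.

(** If [x_t z] is an arc, [z_passage] excludes [z x_{t+2}], so the gap at [t + 1] must be filled by
    [x_{t+1} z]. *)
Lemma z_in_interval s l a b : zcycle s -> pivot s l -> 0 < a -> b < m -> e (nth z s a) z ->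
  (forall t, a < t <= b -> e (nth z s t) z || e z (nth z s t.+1)) ->
  forall t, a <= t <= b -> e (nth z s t) z.
Proof.
move=> sC piv a_gt0 lt_b az filled; elim=> [|t IHt] t_ab; first by lia.
have [at1|at1] := eqVneq a t.+1; first by rewrite -at1.
have tz : e (nth z s t) z by apply: IHt; lia.
have /orP[//|zt] : e (nth z s t.+1) z || e z (nth z s t.+2) by apply: filled; lia.
have [lt_t|ge_t] := ltnP t.+2 m; first by case: (z_passage sC piv _ _ lt_t _ tz zt); lia.
by move: zt; have -> : t.+2 = m; [lia | rewrite zcycle_last // e_irr].
Qed.

(** A crossing into [x_j] forbids the arc [x_{j-1} z], and [j - 1] is at least [l]. *)
Lemma z_not_sink s l : zcycle s -> pivot s l ->
  (forall t, l < t < m -> ~~ e z (nth z s t)) ->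
  (forall t, l <= t -> t.+1 < m -> e (nth z s t) z) -> False.
Proof.
move=> sC piv zU Uz; have [i [j ij]] := crossing_exists sC piv (or_introl zU).
have /and5P[i_gt0 lt_il lt_lj lt_j _] := ij.
by apply: (crossing_dst_z (t := j.-1) sC piv ij); rewrite ?Uz; lia.
Qed.

(** * The case where [z] has no out-neighbour beyond the pivot *)

Section NoForward.

Variables (s : seq T) (l : nat).
Hypotheses (sC : zcycle s) (piv : pivot s l).
Hypothesis zU : forall t, l < t < m -> ~~ e z (nth z s t).

Let s0 : nth z s 0 = z. Proof. by case: sC. Qed.
Let l_gt1 : 1 < l. Proof. by have [] := pivot_bounds sC piv. Qed.
Let lt_l : l.+1 < m. Proof. by have [] := pivot_bounds sC piv. Qed.

Lemma z_out_crossing i j t : crossing s l i j -> i < t -> t < j -> t <= i + 2 ->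
  ~~ e z (nth z s t).
Proof.
move=> ij lt_it lt_tj le_t; apply/negP => zt; have /and5P[i_gt0 _ _ _ _] := ij.
by apply: (crossing_src (p := 0) sC piv ij i_gt0 lt_it lt_tj le_t); rewrite s0.
Qed.

Lemma z_in_crossing i j t : crossing s l i j -> i < t -> t < j -> j <= t + 2 ->
  ~~ e (nth z s t) z.
Proof. by move=> ij *; apply/negP; apply: crossing_dst_z ij _ _ _. Qed.

(* Rerouting along the arc yields an m-cycle whose pivot lies among positions
   i+1, ..., j-3 of [s], all in-neighbours of z, contradicting [z_not_sink]. *)
Lemma no_long_crossing i j : crossing s l i j -> l.+1 < j -> i.+3 < j -> False.
Proof.
move=> ij lt_lj lt_ij; have /and5P[i_gt0 lt_il _ lt_j _] := ij.
have [t jE] : exists t, j = t.+3 by exists (j - 3); lia.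
subst j.
(* An empty gap at [u] would be the third, after [t + 1] and [t + 2]. *)
have filled u : 0 < u <= t -> e (nth z s u) z || e z (nth z s u.+1).
  move=> u_t; apply: contraT; rewrite negb_or => nu.
  case: (@z_gaps s l u t.+1 t.+2 sC piv); try by lia.
  move=> v; rewrite !inE => /or3P[] /eqP-> //.
    by rewrite (z_in_crossing ij) ?zU //; lia.
  by rewrite (z_in_crossing ij) ?zU //; lia.
have iz : e (nth z s i) z.
  have /orP[//|] : e (nth z s i) z || e z (nth z s i.+1) by apply: filled; lia.
  by rewrite (negbTE (z_out_crossing ij _ _ _)) //; lia.
have Iz : forall u, i <= u <= t -> e (nth z s u) z.
  apply: z_in_interval sC piv i_gt0 _ iz _; first by lia.
  by move=> u u_t; apply: filled; lia.
have tz : e (nth z s t) z by apply: Iz; lia.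
have lt_it : i < t by lia.
have := crossing_reroute sC piv ij lt_it tz; set P := i + m - (t + 2).
move=> [s' [y [y' [sC' [ys ys'] PE P1E [_ us' nthE]]]]].
have [l' piv'] := pivot_exists sC'; have [/andP[l'_gt0 lt_l'] outR' inR'] := piv'.
have [_ outR inR] := piv.
have P1_lt : P.+1 < m by rewrite /P; lia.
(* The omitted [x_{t+2}] lies beyond [l], so it receives no arc from [y']; hence the new pivot comes
   after [y']. *)
have lt_P1 : P.+1 < l'.
  by rewrite ltnNge -(inR' _ _ us') // P1E outR //; lia_nat.
have z_pos p : l' <= p < m -> nth z s' p = nth z s (p + t + 1 - m) /\ i < p + t + 1 - m <= t.
  move=> p_l'; split; first by apply: nthE; lia.
  by rewrite /P in lt_P1; lia.
apply: (z_not_sink sC' piv').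
  move=> p p_l'; have [|-> p_t] := z_pos p; first by lia.
  apply/negP => zp.
  have wz : e (nth z s (p + t + 1 - m).-1) z by apply: Iz; lia.
  by apply: (z_passage sC piv _ _ _ _ wz zp); rewrite /P in lt_P1; lia_nat.
move=> p le_p lt_p; have [|-> p_t] := z_pos p; first by lia.
by apply: Iz; lia.
Qed.

(** The only other possibility is the arc [x_{l-1} x_{l+2}]. Then no arc bypasses [x_{l-1}]:
    [crossing_src] excludes an end at [l] or [l + 1], and an end further on would make a long
    crossing. *)
Lemma crossing_short i j : crossing s l i j -> j = l.+1.
Proof.
move=> ij; have /and5P[i_gt0 lt_il lt_lj lt_j _] := ij.
have [//|jl] := eqVneq j l.+1.
have [iE jE] : i = l.-1 /\ j = l.+2.
  by have := no_long_crossing ij; case: (ltnP i.+3 j) => [_ /(_ _ isT) []|]; lia.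
subst i j.
have [|||||||a [b [[le_a le_b Pa nPb bl]]]] :=
  @zcycle_cut s l l.-1 (fun t => t < l.-1) 0 l sC piv; rewrite /= ?ltnn //; try by lia.
case=> [[lt_a lt_b ab] | [aE _] | [_ le_la]]; [|lia|lia].
have [lt_bl|le_lb] := ltnP b l.+2.
  by case: (crossing_src (t := b) sC piv ij Pa _ _ _ ab); lia.
case: a ab Pa le_a lt_a => [|a] ab Pa le_a lt_a.
  by have := zU (t := b); rewrite -{1}s0 ab; lia.
have abC : crossing s l a.+1 b by rewrite /crossing ab; lia.
by case: (no_long_crossing abC); lia.
Qed.

(** Otherwise deleting [x_{l+1}] disconnects the digraph: an arc bypassing it would be a crossing
    not ending at [l + 1], or start at [x_l] against [crossing_dst]. *)
Lemma crossing_last i j : crossing s l i j -> m = l.+2.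
Proof.
move=> ij; have jE := crossing_short ij; subst j; have /and5P[i_gt0 lt_il _ _ _] := ij.
apply/eqP; apply: contraT => ml.
have [|||||||a [b [[le_a le_b Pa nPb bl]]]] :=
  @zcycle_cut s l l.+1 (fun t => (t <= l) || (t == m)) 0 l.+2 sC piv; rewrite /= ?ltnn //; try by lia.
case=> [[lt_a lt_b ab] | [aE b_l] | [bE _]]; [|lia|lia].
case: a ab Pa le_a lt_a => [|a] ab Pa le_a lt_a.
  by have := zU (t := b); rewrite -{1}s0 ab; lia.
have [lt_al|le_la] := ltnP a.+1 l.
  have /crossing_short : crossing s l a.+1 b by rewrite /crossing ab; lia.
  by lia.
have aE : a.+1 = l by lia.
by rewrite aE in ab; case: (crossing_dst (t := l) sC piv ij _ _ _ _ _ ab); lia.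
Qed.

(** If a crossing starts at [l - 1], strength yields an arc bypassing [x_{l-1}], and [crossing_src]
    forces it to end at [l + 1]. *)
Lemma crossing_early : exists2 i, crossing s l i l.+1 & i.+1 < l.
Proof.
have [i [j ij]] := crossing_exists sC piv (or_introl zU).
have mE := crossing_last ij; have jE := crossing_short ij; subst j.
have /and5P[i_gt0 lt_il _ _ _] := ij.
have [lt_i|ge_i] := ltnP i.+1 l; first by exists i.
have [|||||||a [b [[le_a le_b Pa nPb bl]]]] :=
  @zcycle_cut s l l.-1 (fun t => t < l.-1) 0 l sC piv; rewrite /= ?ltnn //; try by lia.
case=> [[lt_a lt_b ab] | [aE _] | [_ le_la]]; [|lia|lia].
have [lt_bl|le_lb] := ltnP b l.+1.
  by case: (crossing_src (t := b) sC piv ij _ _ _ _ ab); lia_nat.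
have bE : b = l.+1 by lia.
subst b; case: a ab Pa le_a lt_a => [|a] ab Pa le_a lt_a.
  by have := zU (t := l.+1); rewrite -{1}s0 ab; lia.
by exists a.+1; rewrite ?/crossing ?ab; lia.
Qed.

(** Otherwise every early crossing starts at [l - 2], and then no arc from an earlier position
    bypasses [x_{l-2}]. *)
Lemma pivot_z_out : e z (nth z s l).
Proof.
apply: contraT => zl; have [i0 ij0 _] := crossing_early; have mE := crossing_last ij0.
have lz : ~~ e (nth z s l) z.
  by have /and5P[? ? ? ? ?] := ij0; apply: (z_in_crossing ij0); lia.
have only i : crossing s l i l.+1 -> i.+1 < l -> i.+2 = l.
  move=> ij lt_i; have /and5P[i_gt0 lt_il _ _ _] := ij.
  apply/eqP; apply: contraT => il.
  have l1z : ~~ e (nth z s l.-1) z by apply: (z_in_crossing ij); lia.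
  have l1E : l.-1.+1 = l by lia.
  have filled u : 0 < u < l.-1 -> e (nth z s u) z || e z (nth z s u.+1).
    move=> u_t; apply: contraT; rewrite negb_or => nu.
    case: (@z_gaps s l u l.-1 l sC piv); try by lia_nat.
    move=> v; rewrite !inE => /or3P[] /eqP-> //; first by rewrite l1z l1E.
    by rewrite lz zU //; lia.
  have iz : e (nth z s i) z.
    have /orP[//|] : e (nth z s i) z || e z (nth z s i.+1) by apply: filled; lia.
    by rewrite (negbTE (z_out_crossing ij _ _ _)) //; lia.
  have [t lE] : exists t, l = t.+2 by exists l.-2; lia.
  have tz : e (nth z s t) z.
    apply: (z_in_interval sC piv i_gt0 _ iz (b := t)); try by lia_nat.
    by move=> u u_t; apply: filled; lia.
  have lt_it : i < t by lia.
  move: (ij); rewrite {2}lE => ij'.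
  have := crossing_reroute sC piv ij' lt_it tz; set P := i + m - (t + 2).
  move=> [s' [y [y' [sC' [ys ys'] PE P1E [us1 us2 nthE]]]]].
  have [l' piv'] := pivot_exists sC'; have [/andP[l'_gt0 lt_l'] outR' inR'] := piv'.
  have [_ outR inR] := piv.
  have P_lt : P < m by rewrite /P; lia_nat.
  (* The omitted [x_{l-1}] and [x_l] must agree on the arc to [y], but only [x_l] has one. *)
  have := outR' _ _ us1 P_lt; have := outR' _ _ us2 P_lt; rewrite PE => <-.
  by rewrite !inR ?lE ?ltnn ?leqnn //; lia_nat.
have [i ij lt_i] := crossing_early; have iE := only i ij lt_i.
have /and5P[i_gt0 lt_il _ _ _] := ij.
have [|||||||a [b [[le_a le_b Pa nPb bl]]]] :=
  @zcycle_cut s l i (fun t => t < i) 0 l sC piv; rewrite /= ?ltnn //; try by lia.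
case=> [[lt_a lt_b ab] | [aE _] | [_ le_la]]; [|lia|lia].
have [lt_bl|le_lb] := ltnP b l.+1.
  by case: (crossing_src (t := b) sC piv ij _ _ _ _ ab); lia_nat.
have bE : b = l.+1 by lia.
subst b; case: a ab Pa le_a lt_a => [|a] ab Pa le_a lt_a.
  by have := zU (t := l.+1); rewrite -{1}s0 ab; lia.
have abC : crossing s l a.+1 l.+1 by rewrite /crossing ab; lia.
by have := only _ abC; lia.
Qed.

(** For an early crossing from [i], if neither [x_i] nor [x_{i+1}] had an arc to [z], the gaps [i],
    [i + 1] and [l] would all be empty. *)
Lemma z_last_in_before_pivot : exists t,
  [/\ 0 < t < l, e (nth z s t) z & forall u, t < u < l -> ~~ e (nth z s u) z].
Proof.
have [i ij lt_i] := crossing_early; have zl := pivot_z_out; have mE := crossing_last ij.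
have /and5P[i_gt0 lt_il _ _ _] := ij.
have nzl u : 0 < u < l -> l <= u + 2 -> ~~ e (nth z s u) z.
  by move=> u_l le_l; apply/negP => uz; apply: (z_passage sC piv _ _ _ _ uz zl); lia_nat.
pose P t := (0 < t < l) && e (nth z s t) z.
have P0 : exists t, P t.
  have [iz|niz] := boolP (e (nth z s i) z); first by exists i; rewrite /P iz; lia.
  have [iz|niz1] := boolP (e (nth z s i.+1) z); first by exists i.+1; rewrite /P iz; lia.
  have i2 : i.+2 < l.
    have [//|il] := ltnP i.+2 l; have lE : l = i.+2 by lia.
    by have := z_out_crossing (t := i.+2) ij; rewrite -lE zl; lia.
  case: (@z_gaps s l i i.+1 l sC piv); try by lia_nat.
  move=> v; rewrite !inE => /or3P[] /eqP->.
  - by rewrite niz (z_out_crossing ij) //; lia_nat.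
  - by rewrite niz1 (z_out_crossing ij) //; lia_nat.
  by rewrite (z_in_crossing ij) ?zU //; lia_nat.
have Pl t : P t -> t <= l by case/andP=> /andP[_ /ltnW].
case: (ex_maxnP P0 Pl) => t /andP[t_l tz] maxt; exists t; split=> // u u_t.
by apply/negP => uz; have := maxt u; rewrite /P uz andbT => /(_ _); lia.
Qed.

(* With t the last in-neighbour of z before l, the m-cycle omitting t+1 and t+2
   must have its pivot at l+1, which makes (l-1, l+1) a crossing of [s]. *)
Lemma no_forward : False.
Proof.
have [i0 ij0 lt_i0] := crossing_early; have zl := pivot_z_out; have mE := crossing_last ij0.
have /and5P[i0_gt0 lt_i0l _ _ _] := ij0.
have lz : ~~ e (nth z s l) z by apply: (z_in_crossing ij0); lia_nat.
have [t [/andP[t_gt0 lt_tl] tz max_t]] := z_last_in_before_pivot.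
have le_t3 : t.+3 <= l.
  by rewrite leqNgt; apply/negP => lt_l3; apply: (z_passage sC piv _ _ _ _ tz zl); lia_nat.
(* Otherwise the gaps [t + 1], [u - 1] and [l] are empty. *)
have Oz u : t.+3 <= u <= l -> e z (nth z s u).
  move=> u_l; apply: contraT => nzu; have uE : u = u.-1.+1 by lia_nat.
  have [ul|lt_ul] := eqVneq u l; first by rewrite ul zl in nzu.
  case: (@z_gaps s l t.+1 u.-1 l sC piv); try by lia_nat.
  move=> v; rewrite !inE => /or3P[] /eqP->.
  - rewrite max_t; last by lia_nat.
    by apply/negP => zt2; apply: (z_passage sC piv _ _ _ _ tz zt2); lia_nat.
  - by rewrite -uE nzu max_t //; lia_nat.
  by rewrite lz zU //; lia_nat.
have lt_t3m : t.+3 < m by lia_nat.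
have zt3 : e z (nth z s t.+3) by apply: Oz; lia_nat.
have [s' [y [[sC' ys yE] [us1 us2 nthE]]]] := passage_reroute sC piv t_gt0 lt_t3m tz zt3.
have [l' piv'] := pivot_exists sC'; have [l'_gt1 lt_l'] := pivot_bounds sC' piv'.
have [_ outR' inR'] := piv'; have [_ outR inR] := piv.
(* The omitted [x_{t+1}] lies before [l], so it has no arc to [y], which sits at position [l - t] of
   [s']. *)
have le_l' : l' <= l - t - 1.
  have lt_P : m - t - 2 < m by lia_nat.
  have lt_t1 : t.+1 < m by lia_nat.
  have := outR' _ _ us1 lt_P; rewrite yE inR // => E.
  have : ~~ (0 < m - t - 2 <= l') by rewrite -E -ltnNge; lia_nat.
  by lia_nat.
have s0' : nth z s' 0 = z by case: sC'.
have zL p : 0 < p < l' -> ~~ e (nth z s' p) z.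
  move=> p_l'; rewrite nthE; last by lia_nat.
  have [->//|pl] := eqVneq (p + t + 2) l.
  by apply: max_t; lia_nat.
(* [z] sends arcs to [x_{t+3} .. x_l] but not to the successor of the start of a crossing; so that
   start is [x_l] and the new pivot is [x_{l+1}]. *)
have only i j : crossing s' l' i j -> i = l - t - 2 /\ l' = l - t - 1.
  move=> ij; have /and5P[i_gt0 lt_il' lt_l'j lt_j _] := ij.
  have : ~~ e z (nth z s' i.+1).
    apply/negP => zi; apply: (crossing_src (p := 0) (t := i.+1) sC' piv' ij); rewrite ?s0' //; lia_nat.
  rewrite nthE; last by lia_nat.
  have [le_il|] := leqP (i.+1 + t + 2) l; last by lia_nat.
  by rewrite Oz //; lia_nat.
have [i [j ij]] := crossing_exists sC' piv' (or_intror zL).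
have [iE l'E] := only i j ij; have /and5P[i_gt0 lt_il' lt_l'j lt_j _] := ij.
(* If [i > 1], no arc from positions [1 .. i - 1] of [s'] bypasses position [i]. *)
have lE : l = t.+3.
  apply/eqP; apply: contraT => l_neq.
  have [|||||||a [b [[le_a le_b Pa nPb bl]]]] :=
    @zcycle_cut s' l' i (fun p => 0 < p < i) 1 0 sC' piv'; rewrite /= ?ltnn ?andbF //; try by lia_nat.
  move: Pa nPb => /= Pa nPb.
  case=> [[lt_a lt_b ab] | [aE _] | [_ le_la]]; [|lia_nat|lia_nat].
  have [b0|b_gt0] := posnP b.
    have /negP[] : ~~ e (nth z s' a) z by apply: zL; lia_nat.
    by rewrite -[X in e _ X]s0' -b0.
  have lt_ib : i < b by lia_nat.
  have [lt_bl|le_lb] := ltnP b l'.+1.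
    by case: (crossing_src (t := b) sC' piv' ij _ _ _ _ ab); lia_nat.
  have abC : crossing s' l' a b by rewrite /crossing ab !andbT; lia_bool.
  by have [] := only _ _ abC; lia_nat.
have l'2 : l' = 2 by lia_nat.
have m_gt2 : 2 < m by lia_nat.
(* Position 2 of [s'] is its pivot [x_{l+1}], so the omitted [x_{t+2}], which is [x_{l-1}], has an
   arc to it. *)
have := outR' _ _ us2 m_gt2; rewrite l'2 nthE; last by lia_nat.
move=> arc; have cr : crossing s l t.+2 l.+1.
  by rewrite /crossing; have -> : l.+1 = 2 + t + 2; [lia_nat | rewrite arc !andbT; lia_bool].
by apply: (crossing_src (p := 0) (t := l) sC piv cr); rewrite ?s0 //; lia_nat.
Qed.

End NoForward.

End Extremal.

(** * Arc reversal *)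

(** The cut condition passes to the reverse digraph through the complement of [v |: S]. *)
Lemma extremal_rev (T : finType) (e : rel T) (z : T) (k m : nat) :
  extremal e z k m -> extremal (fun x y => e y x) z k m.
Proof.
case=> irr cut deg_o deg_z m_gt1 lt_m ge_m maxm.
have degE x : deg (fun x y => e y x) x = deg e x by rewrite /deg addnC.
split=> // [v a b S vS aS bS bv|x|| s].
- have [||||x [y [xS yS yv xy]]] := cut v b a (~: (v |: S)).
  + by rewrite !inE eqxx.
  + by rewrite !inE negb_or bv bS.
  + by rewrite !inE aS orbT.
  + by apply: contraNneq vS => <-.
  exists y, x; split=> //; move: xS yS; rewrite !inE negb_or negbK => /andP[] //.
  by rewrite (negbTE yv).
- by rewrite degE; apply: deg_o.
- by rewrite degE.
move=> /andP[cyc Us] zs; rewrite -(size_rev s) maxm ?mem_rev //.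
by apply/andP; split; rewrite ?rev_uniq // rev_cycle.
Qed.

Lemma zcycle_rev (T : finType) (e : rel T) (z : T) (m : nat) s : 0 < m -> zcycle e z m s ->
  exists2 s', zcycle (fun x y => e y x) z m s' &
    s' =i s /\ forall t, 0 < t < m -> nth z s' t = nth z s (m - t).
Proof.
move=> m_gt0 [/andP[cyc Us] s0 sz]; case: s => [|x s] in cyc Us s0 sz *; first by move: sz m_gt0 => <-.
rewrite /= in s0 sz; subst x m.
have revE : rev (z :: s) = rcons (rev s) z by rewrite rev_cons.
have rotE : rotr 1 (rev (z :: s)) = z :: rev s by rewrite revE rotr1_rcons.
exists (z :: rev s).
  split; rewrite //= ?size_rev //.
  by rewrite -rotE; apply/andP; split; rewrite ?rotr_cycle ?rev_cycle // rotr_uniq rev_uniq.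
split=> [x|[|t] //= lt_t]; first by rewrite !inE mem_rev.
by rewrite nth_rev // subSS; have -> : size s - t = (size s - t.+1).+1 by rewrite subnSK.
Qed.

(** If [z] has an out-neighbour beyond [l], [z_not_across] leaves no in-neighbour at positions
    [0 < t < l]; in the reverse digraph, with pivot [m - l], this is the hypothesis of
    [no_forward]. *)
Lemma no_extremal (T : finType) (e : rel T) (z : T) (k m : nat) s :
  extremal e z k m -> zcycle e z m s -> False.
Proof.
move=> Dex sC; have [l piv] := pivot_exists Dex sC; have [/andP[l_gt0 lt_l] outR inR] := piv.
have m_gt1 := extremal_gt1 Dex.
have [/existsP[j /andP[lt_lj zj]]|noU] := boolP [exists j : 'I_m, (l < j) && e z (nth z s j)]; last first.
  apply: (no_forward Dex sC piv) => t /andP[lt_lt lt_t]; apply: contra noU => zt.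
  by apply/existsP; exists (Ordinal lt_t); rewrite lt_lt.
have Drev := extremal_rev Dex; have [|s' sC' [mem_s' nthE]] := zcycle_rev _ sC; first by lia.
have s0' : nth z s' 0 = z by case: sC'.
have s0 : nth z s 0 = z by case: sC.
have piv' : pivot (fun x y => e y x) z m s' (m - l).
  split=> [|y [|t]|y [|t]]; first by lia_nat.
  - by rewrite mem_s' s0' => ys _; rewrite -s0 inR //; lia_nat.
  - by rewrite mem_s' => ys lt_t; rewrite nthE // inR //; lia_nat.
  - by rewrite mem_s' s0' => ys _; rewrite -s0 outR //; lia_nat.
  - by rewrite mem_s' => ys lt_t; rewrite nthE // outR //; lia_nat.
apply: (no_forward Drev sC' piv') => t /andP[lt_t t_m]; rewrite nthE; last by lia_nat.
by apply/negP => tz; apply: (z_not_across Dex sC piv _ _ lt_lj (ltn_ord j) tz zj); lia_nat.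
Qed.

(** * Reduction of the theorem to extremal configurations *)

(** A path from [a] to [b] in [D - v] has to leave [S]. *)
Lemma two_strong_cut (T : finType) (e : rel T) : two_strong e ->
  forall (v a b : T) (S : {set T}),
    v \notin S -> a \in S -> b \notin S -> b != v ->
    exists x y, [/\ x \in S, y \notin S, y != v & e x y].
Proof.
case=> _ str v a b S vS aS bS bv.
have av : a \notin [set v] by rewrite inE; apply: contraNneq vS => <-.
have bv' : b \notin [set v] by rewrite inE.
have [||[p [pth lst _]] _] := str [set v] _ (exist _ a av) (exist _ b bv').
- by rewrite cards1.
- by apply: contraNneq bS => -[<-].
have: val (exist (fun x => x \notin [set v]) a av) \in S by [].
elim: p (exist _ a av) pth lst => [|y p IHp] x /=.
  by move=> _ ->; rewrite /= (negbTE bS).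
case/andP=> xy pth lst xS; have [yS|yS] := boolP (val y \in S); first exact: IHp y pth lst yS.
by exists (val x), (val y); split=> //; have := valP y; rewrite inE.
Qed.

Theorem theorem6 (k n : nat) (T : finType) (e : rel T) (z : T)
    (e_irr : irreflexive e)
    (card_T : #|T| = n)
    (n_ge3 : 3 <= n)
    (e_2strong : two_strong e)
    (deg_other : forall x : T, x != z -> n + k <= deg e x)
    (deg_z : n - k - 4 <= deg e z)
    (long_cycle : exists c : seq T,
       [/\ dicycle e c, z \in c & n - k - 2 <= size c]) :
  hamiltonian e.
Proof.
have [c [[c_gt1 Uc] zc c_long]] := long_cycle.
(* Tuples make the property decidable, as [ex_maxnP] requires. *)
pose P m := [exists s : m.-tuple T, ucycleb e s && (z \in s)].
have PP s : ucycle e s -> z \in s -> P (size s).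
  by move=> Us zs; apply/existsP; exists (in_tuple s); rewrite /= zs andbT.
have P0 : exists m, P m by exists (size c); apply: PP.
have Pn m : P m -> m <= n.
  case/existsP=> s /andP[/andP[_ Us] _]; rewrite -card_T -[m](size_tuple s).
  by rewrite -(card_uniqP Us) max_card.
case: (ex_maxnP P0 Pn) => m /existsP[s /andP[Us zs]] maxm.
have le_cm : size c <= m by apply: maxm; apply: PP.
have [lt_m|ge_m] := ltnP m n; last first.
  exists s; split; first by split=> //; rewrite size_tuple; apply: leq_trans le_cm.
  have mE : #|s| = #|T|.
    have /andP[_ /card_uniqP->] := Us; rewrite size_tuple card_T.
    apply/eqP; rewrite eqn_leq ge_m andbT; apply: Pn; apply/existsP; exists s; exact/andP.
  by move=> x; have /(subset_cardP mE)-> := subset_predT (mem s).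
(* The rotation brings [z] to position 0. *)
case: (@no_extremal T e z k m (rot (index z s) s)).
  split; rewrite ?card_T //; first exact: two_strong_cut.
  - exact: leq_trans le_cm.
  - exact: leq_trans le_cm.
  by move=> u Uu zu; apply: maxm; apply: PP.
split; last by rewrite size_rot size_tuple.
  by rewrite /ucycle rot_cycle rot_uniq.
by have [i s' _] := rot_to zs; rewrite /rot (drop_nth z) ?index_mem // nth_index.
Qed.
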